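(* Let $(N,d)$ be the tripod with edges $N_1,N_2,N_3$. Let $f:N\to\mathbb{R}$ be a function and let $f_1,f_2,f_3:[0,\infty)\to\mathbb{R}$ be its restrictions to the edges, that is, $$f((i,r))=f_i(r)\qquad (r\ge 0,\ i=1,2,3),$$ so that $f_1(0)=f_2(0)=f_3(0)$. If the functions $f_1$, $f_2$ and $f_3$ are convex and the functions $f_1+f_2$, $f_1+f_3$ and $f_2+f_3$ are nondecreasing on $[0,\infty)$, then $f$ is a convex function on $N$.
   Context: The tripod (3-spider) is the metric space $(N,d)$ obtained by gluing three copies $N_i=\{(i,r): r\ge 0\}$, $i=1,2,3$, of the half-line $[0,\infty)$ at their origins: $$N=\{(i,r): i\in\{1,2,3\},\ r\ge 0\}/\sim,\qquad (i,0)\sim(j,0)\ \text{ for all } i,j,$$ with metric $d((i,r),(j,s))=|r-s|$ if $i=j$ and $d((i,r),(j,s))=|r|+|s|$ otherwise. The common point $o=(1,0)=(2,0)=(3,0)$ is the origin. In $N$ any two points $x_0,x_1$ are joined by a unique constant-speed geodesic $\gamma:[0,1]\to N$, i.e. $\gamma(0)=x_0$, $\gamma(1)=x_1$ and $d(\gamma(s),\gamma(t))=|s-t|\,d(x_0,x_1)$ for all $s,t\in[0,1]$. A function $f:N\to\mathbb{R}$ is convex if for every such geodesic $\gamma$ and every $t\in[0,1]$, $f(\gamma(t))\le(1-t)f(\gamma(0))+t f(\gamma(1))$. *)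

(* Defs.v *)
From HB Require Import structures.
From mathcomp Require Import all_boot all_order all_algebra generic_quotient.
From mathcomp Require Import interval_inference.
From mathcomp Require Import all_classical all_reals all_analysis.
From mathcomp Require Import lra.
Set Implicit Arguments.
Unset Strict Implicit.
Unset Printing Implicit Defensive.
Import Order.TTheory GRing.Theory Num.Theory.
Local Open Scope ring_scope.
Local Open Scope quotient_scope.

(* Geodesics are parametrized by [0, 1]; the values of [g] outside of
   [0, 1] are irrelevant. *)
Definition geodesic (R : realType) (M : metricType R) (g : R -> M) : Prop :=
  {in `[0, 1] &, forall s t : R,
    mdist (g s) (g t) = `|s - t| * mdist (g 0) (g 1)}.

Definition geodesically_convex (R : realType) (M : metricType R)
    (f : M -> R) : Prop :=
  forall g : R -> M, geodesic g ->
  {in `[0, 1], forall t : R, f (g t) <= (1 - t) * f (g 0) + t * f (g 1)}.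

Section Tripod.
Variable R : realType.

Local Notation halflines := ('I_3 * {nonneg R})%type.

Definition glue (p q : halflines) : bool :=
  (p == q) || ((p.2%:num == 0) && (q.2%:num == 0)).

Lemma glue_refl : reflexive glue.
Proof. by move=> p; rewrite /glue eqxx. Qed.

Lemma glue_sym : symmetric glue.
Proof. by move=> p q; rewrite /glue eq_sym [X in _ || X]andbC. Qed.

Lemma glue_trans : transitive glue.
Proof.
move=> q p r /orP[/eqP->//|/andP[p0 q0]] /orP[/eqP<-|/andP[_ r0]].
  by rewrite /glue p0 q0 orbT.
by rewrite /glue p0 r0 orbT.
Qed.

Canonical glue_equiv := EquivRel glue glue_refl glue_sym glue_trans.

Definition tripod : Type := {eq_quot glue}.

HB.instance Definition _ := Choice.on tripod.
HB.instance Definition _ := EqQuotient.on tripod.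

Definition tripod_pt (i : 'I_3) (r : {nonneg R}) : tripod :=
  \pi_tripod (i, r).

Lemma tripod_ptE i r j s :
  (tripod_pt i r == tripod_pt j s) =
  ((i == j) && (r == s)) || ((r%:num == 0) && (s%:num == 0)).
Proof. by rewrite /tripod_pt [LHS]eqquotE. Qed.

Lemma tripod_ptP (x : tripod) : exists i r, x = tripod_pt i r.
Proof.
exists (repr x).1, (repr x).2.
by rewrite /tripod_pt -surjective_pairing reprK.
Qed.

Definition halflines_dist (p q : halflines) : R :=
  if p.1 == q.1 then `|p.2%:num - q.2%:num|
  else `|p.2%:num| + `|q.2%:num|.

Definition tripod_dist (x y : tripod) : R :=
  halflines_dist (repr x) (repr y).

Lemma halflines_distC p q : halflines_dist p q = halflines_dist q p.
Proof. by rewrite /halflines_dist eq_sym distrC [X in if _ then _ else X]addrC. Qed.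

Lemma halflines_dist_glue p p' q :
  glue p p' -> halflines_dist p q = halflines_dist p' q.
Proof.
case/orP => [/eqP->//|/andP[/eqP p0 /eqP p'0]].
rewrite /halflines_dist p0 p'0 sub0r normrN normr0 add0r.
by rewrite !if_same.
Qed.

Lemma tripod_dist_pt i r j s :
  tripod_dist (tripod_pt i r) (tripod_pt j s) =
  if i == j then `|r%:num - s%:num| else `|r%:num| + `|s%:num|.
Proof.
have H (p : halflines) : glue (repr (\pi_tripod p)) p.
  by rewrite -(@eqquotE _ glue tripod) reprK.
rewrite /tripod_dist (halflines_dist_glue _ (H _)) halflines_distC.
by rewrite (halflines_dist_glue _ (H _)) halflines_distC.
Qed.

Lemma tripod_distxx x : tripod_dist x x = 0.
Proof.
by have [i [r ->]] := tripod_ptP x; rewrite tripod_dist_pt eqxx subrr normr0.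
Qed.

Lemma tripod_dist_positivity x y : tripod_dist x y = 0 -> x = y.
Proof.
have [i [r ->]] := tripod_ptP x; have [j [s ->]] := tripod_ptP y.
rewrite tripod_dist_pt => /eqP; case: (eqVneq i j) => [->|ij].
  by rewrite normr_eq0 subr_eq0 => /eqP/val_inj ->.
rewrite paddr_eq0// !normr_eq0 => rs0.
by apply/eqP; rewrite tripod_ptE rs0 orbT.
Qed.

Lemma tripod_dist_sym x y : tripod_dist x y = tripod_dist y x.
Proof. exact: halflines_distC. Qed.

Lemma tripod_dist_triangle y x z :
  tripod_dist x z <= tripod_dist x y + tripod_dist y z.
Proof.
have [i [r ->]] := tripod_ptP x; have [j [s ->]] := tripod_ptP y.
have [k [t ->]] := tripod_ptP z; rewrite !tripod_dist_pt.
have := ler_distD s%:num r%:num t%:num; have := ler_normB r%:num t%:num.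
have := ler_distD s%:num r%:num 0; have := ler_distD s%:num 0 t%:num.
rewrite !subr0 !sub0r !normrN.
have := normr_ge0 r%:num; have := normr_ge0 s%:num; have := normr_ge0 t%:num.
case: (eqVneq i j) => [<-|ij]; first by case: (eqVneq i k) => _; lra.
case: (eqVneq j k) => [<-|jk]; last by case: (eqVneq i k) => _; lra.
by rewrite (negbTE ij); lra.
Qed.

HB.instance Definition _ := isMetric.Build R tripod
  tripod_distxx tripod_dist_positivity tripod_dist_sym tripod_dist_triangle.

Lemma mdist_tripod_pt i r j s :
  mdist (tripod_pt i r) (tripod_pt j s) =
  if i == j then `|r%:num - s%:num| else `|r%:num| + `|s%:num|.
Proof. exact: tripod_dist_pt. Qed.

End Tripod.

(* Main.v *)
Require Import Defs.
From mathcomp Require Import all_boot all_order all_algebra.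
From mathcomp Require Import all_classical all_reals all_analysis.
From mathcomp Require Import ring lra.
Import Order.TTheory GRing.Theory Num.Theory.
Local Open Scope ring_scope.

(* Inside one edge the inequality is the convexity of that edge function.  A
   geodesic from (i, a) to (j, b) with i != j crosses the origin, and convexity
   of the edge functions reduces everything to the inequality at the origin,
   (a + b) f(o) <= b f_i(a) + a f_j(b).  For a <= b, convexity of f_j pulls
   f_j(b) back to f_j(a), and monotonicity of f_i + f_j gives
   2 f(o) <= f_i(a) + f_j(a). *)

Section HalflineConvexity.
Variable R : realType.
Implicit Types (h k : R -> R) (a b c t : R).

Local Notation convex_ge0 h :=
  (convex_function (`[0, +oo[%classic : set R^o) h).

Lemma convex_ge0_le {h a b t} : convex_ge0 h ->
  0 <= a -> 0 <= b -> 0 <= t <= 1 ->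
  h ((1 - t) * a + t * b) <= (1 - t) * h a + t * h b.
Proof.
move=> hconv a0 b0 /andP[t0 t1].
have tP : Itv.spec (@Itv.num_sem R) (Itv.Real `[0%Z, 1%Z]) t.
  by apply/and3P; split; rewrite ?ger0_real//= bnd_simp.
have mem_ge0 x : 0 <= x -> x \in (`[0, +oo[%classic : set R^o).
  by move=> x0; rewrite inE/= in_itv/= x0.
(* [convex_function] puts the weight [t] on its first point, so [b] is passed before [a]. *)
have : h (t * b + (1 - t) * a) <= t * h b + (1 - t) * h a.
  exact: (hconv (Itv.mk tP) b a (mem_ge0 _ b0) (mem_ge0 _ a0)).
by rewrite [t * b + _]addrC [t * h b + _]addrC.
Qed.

(** [c] divides the segment from 0 to [a] with weight [c / a]; multiplying by [a] keeps the case
    [a = 0]. *)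
Lemma convex_ge0_chord {h a c} : convex_ge0 h -> 0 <= c <= a ->
  a * h c <= (a - c) * h 0 + c * h a.
Proof.
move=> hconv /andP[c0 ca]; have [a0|a0] := leP a 0.
  have -> : a = 0 by lra.
  have -> : c = 0 by lra.
  by lra.
have t01 : 0 <= c / a <= 1 by rewrite divr_ge0 ?(ltW a0)//= ler_pdivrMr ?mul1r.
have := convex_ge0_le hconv (lexx 0) (ltW a0) t01.
rewrite mulr0 add0r divfK ?gt_eqF// -(ler_pM2l a0).
by congr (_ <= _); field; rewrite gt_eqF.
Qed.

Lemma convex_ge0_origin_le {h k a b} : convex_ge0 h -> convex_ge0 k ->
  h 0 = k 0 -> {in `[0, +oo[ &, nondecreasing_fun (h \+ k)} ->
  0 <= a -> 0 <= b -> (a + b) * h 0 <= b * h a + a * k b.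
Proof.
wlog ab : h k a b / a <= b => [wl hconv kconv hk0 mono a0 b0|].
  have [ab|/ltW ba] := leP a b; first exact: wl.
  rewrite addrC hk0 [leRHS]addrC; apply: wl => // x y x0 y0 xy.
  by rewrite /= ![k _ + _]addrC; exact: mono.
move=> hconv kconv hk0 mono a0 b0.
have := mono 0 a; rewrite !in_itv/= lexx a0 => /(_ isT isT isT).
rewrite -hk0 => /(ler_wpM2l b0).
have := convex_ge0_chord kconv (introT andP (conj a0 ab)); rewrite -hk0.
lra.
Qed.

(** With [c = (1 - t) * a - t * b] one has [a - c = t * (a + b)], so the [h 0] term of the chord
    bound on [[0, a]] is [t] times the left side of the origin inequality. Dividing by [a]
    concludes. *)
Lemma convex_ge0_crossing_le {h k a b t} : convex_ge0 h -> convex_ge0 k ->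
  h 0 = k 0 -> {in `[0, +oo[ &, nondecreasing_fun (h \+ k)} ->
  0 <= a -> 0 <= b -> 0 <= t -> 0 <= (1 - t) * a - t * b ->
  h ((1 - t) * a - t * b) <= (1 - t) * h a + t * k b.
Proof.
move=> hconv kconv hk0 mono a0 b0 t0 c0.
have tb0 := mulr_ge0 t0 b0; have ta0 := mulr_ge0 t0 a0.
(* If [a = 0], then [c0] forces [t * b = 0], so [t = 0] or [b = 0]. *)
have [a_le0|a_gt0] := leP a 0.
  have az : a = 0 by lra.
  have tbz : t * b = 0 by move: c0; rewrite az mulr0; lra.
  rewrite tbz az mulr0 subr0.
  move/eqP: tbz; rewrite mulf_eq0 => /orP[]/eqP->; first by lra.
  by rewrite -hk0; lra.
have ca : (1 - t) * a - t * b <= a by lra.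
have := convex_ge0_chord hconv (introT andP (conj c0 ca)).
have := convex_ge0_origin_le hconv kconv hk0 mono a0 b0.
move/(ler_wpM2l t0) => O C; rewrite -(ler_pM2l a_gt0); apply: (le_trans C).
move: O; lra.
Qed.

End HalflineConvexity.

Theorem theorem5 (R : realType) (f : tripod R -> R) (fe : 'I_3 -> R -> R)
    (f_edge : forall (i : 'I_3) (r : {nonneg R}),
      f (tripod_pt i r) = fe i r%:num)
    (fe_convex : forall i : 'I_3,
      convex_function (`[0, +oo[%classic : set R^o) (fe i))
    (fe_nondecreasing : forall i j : 'I_3, (i < j)%N ->
      {in `[0, +oo[ &, nondecreasing_fun (fe i \+ fe j)}) :
  geodesically_convex f.
Proof.
have fe0 i j : fe i 0 = fe j 0.
  rewrite -!(f_edge _ 0%:nng); congr f.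
  by apply/eqP; rewrite tripod_ptE !eqxx orbT.
have mono i j : i != j -> {in `[0, +oo[ &, nondecreasing_fun (fe i \+ fe j)}.
  rewrite neq_ltn => /orP[/fe_nondecreasing//|/fe_nondecreasing ji] x y x0 y0 xy.
  by rewrite /= ![fe i _ + _]addrC; exact: ji.
have crossing i j a b t c : i != j -> 0 <= a -> 0 <= b -> 0 <= t -> 0 <= c ->
    c = (1 - t) * a - t * b -> fe i c <= (1 - t) * fe i a + t * fe j b.
  move=> ij a0 b0 t0 + cE; rewrite cE.
  exact: convex_ge0_crossing_le (mono _ _ ij) a0 b0 t0.
move=> g geo t; rewrite in_itv/= => /andP[t0 t1].
have I0 : 0 \in `[0, 1 : R] by rewrite in_itv/= lexx ler01.
have I1 : 1 \in `[0, 1 : R] by rewrite in_itv/= lexx ler01.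
have It : t \in `[0, 1] by rewrite in_itv/= t0 t1.
(* The distances from [g t] to both endpoints suffice to locate it. *)
move: (geo _ _ It I0) (geo _ _ It I1).
rewrite subr0 (ger0_norm t0) [`|t - 1|]distrC ger0_norm ?subr_ge0//.
have [i [a ->]] := tripod_ptP (g 0); have [j [b ->]] := tripod_ptP (g 1).
(* The origin lies on every edge; represent it on edge i if g t is the origin. *)
have [k [c [-> c0k]]] : exists k (c : {nonneg R}),
    g t = tripod_pt k c /\ (c%:num = 0 -> k = i).
  have [k [c ->]] := tripod_ptP (g t).
  have [c0|c0] := eqVneq c%:num 0; last first.
    by exists k, c; split=> // /eqP; rewrite (negPf c0).
  by exists i, c; split=> //; apply/eqP; rewrite tripod_ptE c0 !eqxx /= orbT.
rewrite !f_edge !mdist_tripod_pt.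
have [a0 b0 c0] : [/\ 0 <= a%:num, 0 <= b%:num & 0 <= c%:num] by split.
move: a%:num b%:num c%:num a0 b0 c0 c0k => {}a {}b {}c a0 b0 c0 c0k.
rewrite !(ger0_norm a0, ger0_norm b0, ger0_norm c0).
have [ki|ki] := eqVneq k i; last first.
  have {c0k} c_neq0 : c != 0 by apply: contra_neqN ki => /eqP/c0k.
  have c_gt0 : 0 < c by rewrite lt_neqAle eq_sym c_neq0.
  (* If edge [k] contains neither endpoint, the two distances add up to [a + b + 2 * c], more than
     the distance between the endpoints, as [c > 0]. *)
  have [ij|ij] := eqVneq i j.
    by rewrite -ij (negPf ki); case: (lerP b a); lra.
  have [kj|kj] := eqVneq k j; last by lra.
  (* Here [g t] is past the origin: reverse the geodesic, exchanging [t] and [1 - t]. *)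
  rewrite kj => dta dtb; rewrite eq_sym in ij.
  have -> : (1 - t) * fe i a + t * fe j b =
            (1 - (1 - t)) * fe j b + (1 - t) * fe i a by ring.
  by apply: crossing ij b0 a0 _ c0 _; lra.
rewrite ki {c0k}; have [<-|ij] := eqVneq i j => dta dtb.
  have -> : c = (1 - t) * a + t * b.
    by move: dta dtb; case: (lerP a c); case: (lerP b c); case: (lerP b a); lra.
  by apply: convex_ge0_le; rewrite ?t0.
(* The distance to [g 1] reads [c + b = (1 - t) * (a + b)], which gives [c]. *)
apply: crossing ij a0 b0 t0 c0 _; lra.
Qed.
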